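(* Let $X$ be a real vector space with two angularly equivalent norms $\|\cdot\|_1$ and $\|\cdot\|_2$, and let $0\ne x\in X$. Then $x/\|x\|_1$ is an exposed point of the closed unit ball $B_{(X,\|\cdot\|_1)}$ if and only if $x/\|x\|_2$ is an exposed point of the closed unit ball $B_{(X,\|\cdot\|_2)}$.
   Context: For a real normed space $(X,\|\cdot\|)$ and $x,y\in X$, define $g^{\pm}(x,y)=\|x\|\lim_{t\to 0^{\pm}}\frac1t(\|x+ty\|-\|x\|)$ (these one-sided limits always exist) and the $g$-functional $g(x,y)=\frac12(g^+(x,y)+g^-(x,y))$. For non-zero $x,y$ the norm angle from $x$ to $y$ is $\theta(x,y)\in[0,\pi]$ with $\cos\theta(x,y)=\frac{g(x,y)}{\|x\|\|y\|}$. Two norms $\|\cdot\|_1,\|\cdot\|_2$ on a real vector space $X$, with norm angles $\theta_1,\theta_2$, are angularly equivalent if there is a constant $C$ such that $\tan\left(\frac{\theta_2(x,y)}{2}\right)\le C\tan\left(\frac{\theta_1(x,y)}{2}\right)$ for all non-zero $x,y\in X$, where $\tan(\pi/2)$ is taken to be $+\infty$. (This is a symmetric relation.) A point $x$ of a nonempty closed convex subset $K$ of a real normed space $X$ is an exposed point of $K$ if there is $f\in X^*$ that is bounded above on $K$ and attains its supremum on $K$ at $x$ and only at $x$. *)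

(* Defs.v *)
From HB Require Import structures.
From mathcomp Require Import all_boot all_order all_algebra.
From mathcomp Require Import all_classical all_reals all_analysis.
Set Implicit Arguments.
Unset Strict Implicit.
Unset Printing Implicit Defensive.
Import Order.TTheory GRing.Theory Num.Theory.
Import numFieldNormedType.Exports.
Local Open Scope classical_set_scope.
Local Open Scope ring_scope.

(* A norm on a real vector space is data here, since
   several norms are put on the same space; nonnegativity and N 0 = 0 follow
   from the three axioms. *)
Record vnorm (R : realType) (X : lmodType R) := VNorm {
  vnorm_fun :> X -> R;
  vnormD : forall x y, vnorm_fun (x + y) <= vnorm_fun x + vnorm_fun y;
  vnormZ : forall (l : R) x, vnorm_fun (l *: x) = `|l| * vnorm_fun x;
  vnorm_eq0 : forall x, vnorm_fun x = 0 -> x = 0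
}.

(* The normed space (X, N): an alias of X whose norm and topology are those
   given by N. *)
Definition normed_by (R : realType) (X : lmodType R) (N : vnorm X) : Type := X.

HB.instance Definition _ (R : realType) (X : lmodType R) (N : vnorm X) :=
  GRing.Lmodule.copy (normed_by N) X.
HB.instance Definition _ (R : realType) (X : lmodType R) (N : vnorm X) :=
  Lmodule_isNormed.Build R (normed_by N)
    (vnormD N) (vnormZ N) (@vnorm_eq0 R X N).

Section NormAngle.
Variables (R : realType) (V : normedModType R).
Implicit Types x y : V.

Definition g_plus x y : R :=
  `|x| * lim (t^-1 * (`|x + t *: y| - `|x|) @[t --> (0 : R)^'+]).

Definition g_minus x y : R :=
  `|x| * lim (t^-1 * (`|x + t *: y| - `|x|) @[t --> (0 : R)^'-]).

Definition g_functional x y : R := 2^-1 * (g_plus x y + g_minus x y).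

(* Only meaningful for non-zero x and y. The argument of acos then lies in
   [-1, 1], where acos c is the unique angle in [0, pi] whose cosine is c. *)
Definition norm_angle x y : R := acos (g_functional x y / (`|x| * `|y|)).

End NormAngle.

(* The library's tan takes the value 0 at pi / 2. *)
Definition etan (R : realType) (a : R) : \bar R :=
  if a == pi / 2 then +oo%E else (tan a)%:E.

(* No sign condition is needed on C: the case y = - x, where both angles are
   pi, forces C > 0 as soon as X contains a non-zero vector. *)
Definition angularly_equivalent (R : realType) (X : lmodType R)
    (N1 N2 : vnorm X) : Prop :=
  exists C : R, forall x y : X, x != 0 -> y != 0 ->
    (etan (@norm_angle R (normed_by N2) x y / 2)%R
      <= C%:E * etan (@norm_angle R (normed_by N1) x y / 2)%R)%E.

Section ExposedPoint.
Variables (R : realType) (V : normedModType R).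

(* Meant for a nonempty closed convex set K. *)
Definition exposed_point (K : set V) (x : V) : Prop :=
  K x /\ exists f : {linear V -> R^o},
    [/\ continuous f,
        has_ubound (f @` K : set R),
        f x = sup (f @` K : set R)
      & forall y, K y -> f y = sup (f @` K : set R) -> y = x].

Definition closed_unit_ball : set V := [set y | `|y| <= 1].

End ExposedPoint.

Arguments closed_unit_ball {R} V.

(* Main.v *)
Require Import Defs.
From HB Require Import structures.
From mathcomp Require Import all_boot all_order all_algebra.
From mathcomp Require Import all_classical all_reals all_analysis.
From mathcomp Require Import ring lra.
Set Implicit Arguments.
Unset Strict Implicit.
Unset Printing Implicit Defensive.
Import Order.TTheory GRing.Theory Num.Theory.
Import numFieldNormedType.Exports.
Local Open Scope classical_set_scope.
Local Open Scope ring_scope.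

(* Write p_i for the right derivative of N_i at x and f0 for a functional
   exposing x for N1. If a linear f satisfies f <= p_2 - c (p_1 - f0) for some
   c > 0, then f supports N2 at x, and f v = N2 v forces p_1 v <= f0 v; moreover
   N2, hence N1, is additive on x and t v (the angle from x + t v to x is 0), so
   p_1 v = N1 v, f0 v = N1 v and v is a nonnegative multiple of x. Thus f exposes
   x for N2. By Hahn-Banach such an f exists as soon as
     c (p_1 v_1 + ... + p_1 v_n) <= p_2 v_1 + ... + p_2 v_n
   whenever v_1 + ... + v_n = 0, a condition not involving f0.

   Angular equivalence gives 1 - cos theta_1 <= K (1 - cos theta_2). At a base
   point z where both norms are differentiable in the directions x + h v_i, the
   derivatives are additive on these vectors, so summing this inequality over i
   yields sum (N1 (x + h v_i) - N1 x) <= K r sum (N2 (x + h v_i) - N2 x) as z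
   tends to x, where r bounds N1 / N2 on the x + h v_i. Letting h tend to 0 gives
   the required condition. Instead of differentiability almost everywhere in
   finite dimension, it suffices that near x there are points whose second
   differences in finitely many directions are arbitrarily small. *)

(** * Sublinear functionals and Hahn-Banach theorems *)

Section Sublinear.
Variables (R : realType) (X : lmodType R).
Implicit Types (p q : X -> R) (u v : X).

Definition sublinear p : Prop :=
  (forall u v, p (u + v) <= p u + p v) /\
  (forall t v, 0 < t -> p (t *: v) <= t * p v).

(** Common source of sublinearity for all the infima below: directional perturbations, chains in
    Zorn's lemma, decompositions of a vector, difference quotients of a norm. *)
Lemma inf_sublinear (S : X -> set R) :
  (forall v, has_inf (S v)) ->
  (forall u v a b, S u a -> S v b -> exists2 c, S (u + v) c & c <= a + b) ->
  (forall t v a, 0 < t -> S v a -> exists2 c, S (t *: v) c & c <= t * a) ->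
  sublinear (fun v => inf (S v)).
Proof.
move=> Sinf SD SZ.
have infP v c : S v c -> inf (S v) <= c.
  by move=> Sc; apply: ge_inf => //; case: (Sinf v).
split=> [u v|t v t0].
- apply/ler_addgt0Pr => e e0.
  have e20 : 0 < e / 2 by rewrite divr_gt0.
  have [a Sa la] := inf_adherent e20 (Sinf u).
  have [b Sb lb] := inf_adherent e20 (Sinf v).
  have [c Sc lc] := SD _ _ _ _ Sa Sb.
  have := infP _ _ Sc; lra.
- rewrite -ler_pdivrMl//; apply: lb_le_inf; first by case: (Sinf v).
  move=> a Sa; rewrite ler_pdivrMl//.
  have [c Sc lc] := SZ _ _ _ t0 Sa.
  exact: le_trans (infP _ _ Sc) lc.
Qed.

Section SublinearTheory.
Variables (p : X -> R) (psub : sublinear p).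

Lemma sublinearZ t v : 0 < t -> p (t *: v) = t * p v.
Proof.
move=> t0; apply/eqP; rewrite eq_le psub.2//= -ler_pdivlMl//.
rewrite -[X in p X](scalerK (lt0r_neq0 t0)).
by apply: psub.2; rewrite invr_gt0.
Qed.

Lemma sublinear0 : p 0 = 0.
Proof.
have := @sublinearZ 2 0 (ltr0n _ 2).
by rewrite scaler0; lra.
Qed.

Lemma sublinear_geN v : - p (- v) <= p v.
Proof. by have := psub.1 v (- v); rewrite subrr sublinear0; lra. Qed.

Lemma sublinear_sum (I : Type) (s : seq I) (F : I -> X) :
  p (\sum_(i <- s) F i) <= \sum_(i <- s) p (F i).
Proof.
elim: s => [|i s IHs]; first by rewrite !big_nil sublinear0.
by rewrite !big_cons; apply: le_trans (psub.1 _ _) _; rewrite lerD2l.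
Qed.

(** This keeps pointwise infima over chains of minorants finite. *)
Lemma sublinear_lbound q : sublinear q -> (forall v, q v <= p v) ->
  forall v, - p (- v) <= q v.
Proof.
move=> qsub qp v; have := psub.1 v (- v); have := qsub.1 v (- v).
rewrite subrr sublinear0; have := qp (- v); have := qsub.1 0 0.
by rewrite addr0; lra.
Qed.

End SublinearTheory.

(* The right derivative of [p] at [y] is again sublinear, so minimality forces
   it to be [p] itself, which makes [p] superadditive. *)
Lemma minimal_sublinear_additive p : sublinear p ->
  (forall q, sublinear q -> (forall v, q v <= p v) -> q = p) ->
  forall u v, p (u + v) = p u + p v.
Proof.
move=> psub pmin u y.
(* With [t = 1 / s], homogeneity turns the entry into the difference quotient
   [(p (y + s *: v) - p y) / s]. *)
pose S v := [set p (v + t *: y) - t * p y | t in [set t : R | 0 < t]].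
have Slb v : lbound (S v) (- p (- v)).
  move=> _ [t /= t0 <-]; rewrite -sublinearZ//.
  have := psub.1 (v + t *: y) (- v); rewrite addrAC subrr add0r; lra.
have Sinf v : has_inf (S v).
  split; last by exists (- p (- v)).
  by exists (p (v + 1 *: y) - 1 * p y), 1 => //=.
have Ssub : sublinear (fun v => inf (S v)).
  apply: inf_sublinear => // [v w _ _ [s /= s0 <-] [t /= t0 <-]|r v _ r0 [t /= t0 <-]].
    exists (p (v + w + (s + t) *: y) - (s + t) * p y).
      by exists (s + t) => //=; rewrite addr_gt0.
    have := psub.1 (v + s *: y) (w + t *: y).
    rewrite addrACA -scalerDl; lra.
  exists (p (r *: v + (r * t) *: y) - (r * t) * p y).
    by exists (r * t) => //=; rewrite mulr_gt0.
  by rewrite -scalerA -scalerDr sublinearZ//; lra.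
have Sp v : inf (S v) <= p v.
  apply: le_trans (_ : p (v + 1 *: y) - 1 * p y <= _).
    by apply: ge_inf; [case: (Sinf v)|exists 1 => //=].
  by rewrite scale1r mul1r; have := psub.1 v y; lra.
have E := pmin _ Ssub Sp.
apply/eqP; rewrite eq_le psub.1//=.
have : inf (S u) <= p (u + 1 *: y) - 1 * p y.
  by apply: ge_inf; [case: (Sinf u)|exists 1 => //=].
by rewrite (congr1 (fun h => h u) E) scale1r mul1r; lra.
Qed.

(** Zorn gives a minimal sublinear minorant of [p]; minimality makes it additive, hence odd, and
    with positive homogeneity linear. *)
Lemma hahn_banach p : sublinear p ->
  exists f : {linear X -> R^o}, forall v, f v <= p v.
Proof.
move=> psub.
pose Q q := sublinear q /\ forall v, q v <= p v.
pose T := {q : X -> R | Q q}.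
(* The order is reversed, so a maximal element is a pointwise minimal functional. *)
pose r (a b : T) := `[< forall v, sval b v <= sval a v >].
have valT_inj (a b : T) : sval a = sval b -> a = b.
  case: a b => [a Pa] [b Pb] /= ab; subst b.
  by rewrite (Prop_irrelevance Pa Pb).
have [] := @Zorn T r.
- by move=> a; apply/asboolP.
- move=> a b c /asboolP ab /asboolP bc; apply/asboolP => v.
  exact: le_trans (bc v) (ab v).
- move=> a b /asboolP ab /asboolP ba; apply: valT_inj; apply/funext => v.
  by apply/eqP; rewrite eq_le ab ba.
- move=> A totA; have [[a0 Aa0]|A0] := pselect (A !=set0); last first.
    have Pp : sublinear p /\ forall v, p v <= p v by [].
    by exists (exist Q p Pp) => a Aa; case: A0; exists a.
  pose S v := [set sval a v | a in A].
  have Slb v : lbound (S v) (- p (- v)).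
    by move=> _ [a /= Aa <-]; case: (svalP a) => sa ap; exact: sublinear_lbound.
  have Sinf v : has_inf (S v).
    by split; [exists (sval a0 v), a0|exists (- p (- v))].
  have Sle a v : A a -> inf (S v) <= sval a v.
    by move=> Aa; apply: ge_inf; [case: (Sinf v)|exists a].
  have Ssub : sublinear (fun v => inf (S v)).
    apply: inf_sublinear => // [u v _ _ [a Aa <-] [b Ab <-]|t v _ t0 [a Aa <-]].
      have [/asboolP ab|/asboolP ba] := totA _ _ Aa Ab.
        exists (sval b (u + v)); first by exists b.
        by apply: le_trans ((svalP b).1.1 _ _) _; rewrite lerD2r ab.
      exists (sval a (u + v)); first by exists a.
      by apply: le_trans ((svalP a).1.1 _ _) _; rewrite lerD2l ba.
    exists (sval a (t *: v)); first by exists a.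
    exact: (svalP a).1.2.
  have Sp v : inf (S v) <= p v by apply: le_trans (Sle a0 v Aa0) ((svalP a0).2 v).
  exists (exist Q _ (conj Ssub Sp)) => a Aa; apply/asboolP => v /=.
  exact: Sle.
move=> [q [qsub qp]] qmax.
have qadd : forall u v, q (u + v) = q u + q v.
  apply: minimal_sublinear_additive => // q' q'sub q'q.
  have q'p v : q' v <= p v by apply: le_trans (q'q v) (qp v).
  by have /(congr1 sval) := qmax (exist Q q' (conj q'sub q'p)) (asboolT q'q).
have qN v : q (- v) = - q v.
  by have := qadd v (- v); rewrite subrr sublinear0//; lra.
have qlin : linear (q : X -> R^o).
  move=> t u v; rewrite qadd; congr (_ + _).
  have [t0|t0|->] := ltgtP t 0; last by rewrite !scale0r sublinear0.
    rewrite -[t]opprK [in LHS]scaleNr qN sublinearZ ?oppr_gt0//.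
    by rewrite scaleNr.
  by rewrite sublinearZ.
pose qL := GRing.isLinear.Build R X R^o *:%R q qlin.
pose f : {linear X -> R^o} := HB.pack q qL.
by exists f.
Qed.

(* The largest sublinear minorant of [r] is
   [v |-> inf { sum r w_i | sum w_i = v }]. *)
Lemma linear_minorant (r : X -> R) :
  (forall t v, 0 < t -> r (t *: v) = t * r v) ->
  (forall s : seq X, \sum_(v <- s) v = 0 -> 0 <= \sum_(v <- s) r v) ->
  exists f : {linear X -> R^o}, forall v, f v <= r v.
Proof.
move=> rZ r0.
pose S v := [set \sum_(w <- s) r w | s in [set s : seq X | \sum_(w <- s) w = v]].
have Slb v : lbound (S v) (- r (- v)).
  (* Adding [- v] to a decomposition of [v] gives a list of sum zero, which bounds the infimum
     below. *)
  move=> _ [s /= sv <-]; have := r0 (- v :: s).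
  by rewrite !big_cons sv addNr => /(_ erefl); lra.
have Sr v : S v (r v) by exists [:: v] => /=; rewrite big_seq1.
have Sinf v : has_inf (S v).
  by split; [exists (r v)|exists (- r (- v))].
have Ssub : sublinear (fun v => inf (S v)).
  apply: inf_sublinear => // [u v _ _ [s /= su <-] [s' /= sv <-]|t v _ t0 [s /= sv <-]].
    exists (\sum_(w <- s ++ s') r w); last by rewrite big_cat.
    by exists (s ++ s') => //=; rewrite big_cat /= su sv.
  exists (\sum_(w <- [seq t *: w | w <- s]) r w).
    by exists [seq t *: w | w <- s] => //=; rewrite big_map -scaler_sumr sv.
  by rewrite big_map mulr_sumr; apply: ler_sum => w _; rewrite rZ.
have [f fS] := hahn_banach Ssub.
exists f => v; apply: le_trans (fS v) _.
by apply: ge_inf => //; case: (Sinf v).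
Qed.

End Sublinear.

(** * One-sided derivatives of a norm and the norm angle *)

Section NormDerivative.
Variables (R : realType) (X : lmodType R) (N : vnorm X).
Implicit Types (u v x y z : X) (s t c : R).

Lemma vnorm0 : N 0 = 0.
Proof. by rewrite -(scale0r 0) vnormZ normr0 mul0r. Qed.

Lemma vnormN v : N (- v) = N v.
Proof. by rewrite -scaleN1r vnormZ normrN1 mul1r. Qed.

Lemma vnorm_ge0 v : 0 <= N v.
Proof. by have := vnormD N v (- v); rewrite subrr vnorm0 vnormN; lra. Qed.

Lemma vnorm_gt0 v : v != 0 -> 0 < N v.
Proof.
move=> v0; rewrite lt_neqAle vnorm_ge0 andbT eq_sym.
by apply: contraNneq v0 => /vnorm_eq0 ->.
Qed.

Lemma vnormZp t v : 0 <= t -> N (t *: v) = t * N v.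
Proof. by move=> t0; rewrite vnormZ ger0_norm. Qed.

Lemma vnormBC u v : N (u - v) = N (v - u).
Proof. by rewrite -vnormN opprB. Qed.

Lemma vnormB_le u v : N u - N v <= N (u - v).
Proof. by have := vnormD N (u - v) v; rewrite subrK; lra. Qed.

Definition dquot z v t : R := t^-1 * (N (z + t *: v) - N z).

(** The right derivative of [N] at [z] along [v]: by convexity the quotient is monotone in [t], so
    its limit at [0+] is its infimum. *)
Definition dnorm z v : R := inf [set dquot z v t | t in [set t : R | 0 < t]].

(** The left derivative along [v] is [- dnorm z (- v)], so this is the g-functional divided by
    [N z]. *)
Definition mean_dnorm z v : R := (dnorm z v - dnorm z (- v)) / 2.

(** Convexity: [z + s *: v] is the combination of [z] and [z + t *: v] with weights [1 - s / t] and
    [s / t]. *)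
Lemma dquot_homo z v s t : 0 < s -> s <= t -> dquot z v s <= dquot z v t.
Proof.
move=> s0 st; have t0 := lt_le_trans s0 st.
rewrite /dquot ler_pdivrMl// mulrA.
have -> : z + s *: v = (1 - s / t) *: z + (s / t) *: (z + t *: v).
  rewrite scalerDr addrA -scalerDl subrK scale1r scalerA.
  by rewrite divfK ?lt0r_neq0.
have st1 : s / t <= 1 by rewrite ler_pdivrMr// mul1r.
have st0 : 0 <= s / t by rewrite divr_ge0 ?ltW.
have := vnormD N ((1 - s / t) *: z) ((s / t) *: (z + t *: v)).
by rewrite !vnormZp ?subr_ge0//; lra.
Qed.

Lemma dquot_lbound z v :
  lbound [set dquot z v t | t in [set t : R | 0 < t]] (- N v).
Proof.
move=> _ [t /= t0 <-]; rewrite /dquot ler_pdivlMl//.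
have := vnormB_le z (z + t *: v).
by rewrite vnormBC [z + _ - z]addrAC subrr add0r vnormZp ?(ltW t0)//; lra.
Qed.

Lemma dquot_has_inf z v :
  has_inf [set dquot z v t | t in [set t : R | 0 < t]].
Proof.
split; first by exists (dquot z v 1), 1 => /=.
by exists (- N v); exact: dquot_lbound.
Qed.

Lemma dnorm_le_dquot z v t : 0 < t -> dnorm z v <= dquot z v t.
Proof.
by move=> t0; apply: ge_inf; [case: (dquot_has_inf z v)|exists t].
Qed.

Lemma dnorm_le z v t : 0 < t -> t * dnorm z v <= N (z + t *: v) - N z.
Proof.
by move=> t0; rewrite -ler_pdivlMl//; apply: dnorm_le_dquot.
Qed.

Lemma dnorm_ge z v c :
  (forall t, 0 < t -> t * c <= N (z + t *: v) - N z) -> c <= dnorm z v.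
Proof.
move=> h; apply: lb_le_inf; first by case: (dquot_has_inf z v).
by move=> _ [t /= t0 <-]; rewrite /dquot ler_pdivlMl// h.
Qed.

Lemma dnorm_sublinear z : sublinear (dnorm z).
Proof.
apply: inf_sublinear.
- exact: dquot_has_inf.
- move=> u v _ _ [s /= s0 <-] [t /= t0 <-].
  set r := Num.min s t.
  have r0 : 0 < r by rewrite lt_min s0.
  (* Halving the step makes [z + (r / 2) *: (u + v)] the midpoint of [z + r *: u] and
     [z + r *: v]. *)
  exists (dquot z (u + v) (r / 2)); first by exists (r / 2); rewrite //= divr_gt0.
  apply: le_trans (_ : dquot z u r + dquot z v r <= _); last first.
    by rewrite lerD// dquot_homo// ge_min lexx ?orbT.
  rewrite /dquot invfM invrK -mulrA -mulrDr ler_pM2l ?invr_gt0//.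
  have E : z + (r / 2) *: (u + v) = 2^-1 *: (z + r *: u) + 2^-1 *: (z + r *: v).
    rewrite -scalerDr addrACA -scalerDr [RHS]scalerDr scalerA [2^-1 * r]mulrC.
    by rewrite -[z in z + z]scale1r -scalerDl scalerA mulVf ?scale1r// pnatr_eq0.
  have := vnormD N (2^-1 *: (z + r *: u)) (2^-1 *: (z + r *: v)).
  by rewrite -E !vnormZp ?invr_ge0//; lra.
- move=> t v _ t0 [s /= s0 <-].
  exists (dquot z (t *: v) (s / t)); first by exists (s / t); rewrite //= divr_gt0.
  by rewrite /dquot scalerA divfK ?lt0r_neq0// invf_div mulrA.
Qed.

Lemma dnorm_le_norm z v : dnorm z v <= N v.
Proof.
have := dnorm_le z v ltr01; rewrite mul1r scale1r.
by have := vnormD N z v; lra.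
Qed.

Lemma dnorm_geN z v : - N v <= dnorm z v.
Proof.
have := sublinear_geN (dnorm_sublinear z) v.
by have := dnorm_le_norm z (- v); rewrite vnormN; lra.
Qed.

Lemma dnorm_self z : dnorm z z = N z.
Proof.
apply/eqP; rewrite eq_le dnorm_le_norm/=; apply: dnorm_ge => t t0.
have -> : z + t *: z = (1 + t) *: z by rewrite scalerDl scale1r.
by rewrite vnormZp; lra.
Qed.

Lemma dnormN_self z : dnorm z (- z) = - N z.
Proof.
apply/eqP; rewrite eq_le -{2}(vnormN z) dnorm_geN andbT.
have := @dnorm_le z (- z) 2^-1 ltac:(by rewrite invr_gt0).
have -> : z + 2^-1 *: (- z) = 2^-1 *: z.
  by rewrite scalerN -[X in X - _]scale1r -scalerBl; congr (_ *: _); field.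
by rewrite vnormZp; lra.
Qed.

Lemma mean_dnormN z v : mean_dnorm z (- v) = - mean_dnorm z v.
Proof. by rewrite /mean_dnorm [- - v]opprK; lra. Qed.

Lemma mean_dnorm_le z v : mean_dnorm z v <= N v.
Proof.
rewrite /mean_dnorm; have := dnorm_le_norm z v.
by have := dnorm_geN z (- v); rewrite vnormN; lra.
Qed.

Lemma mean_dnorm_geN z v : - N v <= mean_dnorm z v.
Proof. by have := mean_dnorm_le z (- v); rewrite mean_dnormN vnormN; lra. Qed.

Lemma dquot_cvg z v : dquot z v t @[t --> 0^'+] --> dnorm z v.
Proof.
have posE : [set` `]0, +oo[] = [set t : R | 0 < t].
  by apply/seteqP; split => t /=; rewrite in_itv/= andbT.
rewrite /dnorm -posE; apply: nondecreasing_at_right_cvgr => //.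
  by move=> s t; rewrite !in_itv/= !andbT => s0 t0; exact: dquot_homo.
by exists (- N v); rewrite posE; exact: dquot_lbound.
Qed.

Lemma g_functionalE z v :
  @g_functional R (normed_by N) z v = N z * mean_dnorm z v.
Proof.
have -> : @g_functional R (normed_by N) z v = 2^-1 *
  (N z * lim (dquot z v t @[t --> (0 : R)^'+]) +
   N z * lim (dquot z v t @[t --> (0 : R)^'-])) by [].
have -> : lim (dquot z v t @[t --> (0 : R)^'+]) = dnorm z v.
  by apply: cvg_lim => //; exact: dquot_cvg.
have -> : lim (dquot z v t @[t --> (0 : R)^'-]) = - dnorm z (- v).
  apply: cvg_lim => //; apply/cvg_at_leftNP; rewrite oppr0.
  rewrite [X in X @ _ --> _](_ : _ = \- (dquot z (- v))).
    by apply: cvgN; exact: dquot_cvg.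
  by apply/funext => t /=; rewrite /dquot invrN mulNr scaleNr scalerN.
by rewrite /mean_dnorm; lra.
Qed.

Lemma norm_angleE z v : z != 0 ->
  @norm_angle R (normed_by N) z v = acos (mean_dnorm z v / N v).
Proof.
move=> z0.
have -> : @norm_angle R (normed_by N) z v =
  acos (@g_functional R (normed_by N) z v / (N z * N v)) by [].
rewrite g_functionalE; congr acos.
by rewrite invfM mulrACA mulfV ?mul1r// lt0r_neq0 ?vnorm_gt0.
Qed.

Lemma mean_dnorm_cos z v : v != 0 -> -1 <= mean_dnorm z v / N v <= 1.
Proof.
move=> v0; have Nv := vnorm_gt0 v0.
by rewrite ler_pdivlMr// ler_pdivrMr// mulN1r mul1r mean_dnorm_geN mean_dnorm_le.
Qed.

End NormDerivative.

(** * Angular equivalence in terms of cosines, and exposing functionals *)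

(* [tan (a / 2) ^ 2 = (1 - cos a) / (1 + cos a)]. *)
Lemma etan_acos_le (R : realType) (C c1 c2 : R) :
  -1 <= c1 <= 1 -> -1 <= c2 <= 1 ->
  (etan (acos c2 / 2)%R <= C%:E * etan (acos c1 / 2)%R)%E ->
  (1 - c2) * (1 + c1) <= C ^+ 2 * ((1 - c1) * (1 + c2)).
Proof.
move=> c1b c2b.
have tanP c : -1 <= c <= 1 -> acos c / 2 != pi / 2 ->
    0 <= tan (acos c / 2) /\ tan (acos c / 2) ^+ 2 * (1 + c) = 1 - c.
  move=> cb ne; set a := acos c / 2.
  have ca : cos (a *+ 2) = c by rewrite /a -mulr_natr divfK// acosK.
  have a0 : 0 <= a by rewrite divr_ge0// acos_ge0.
  have api : a < pi / 2.
    by rewrite lt_neqAle ne /= ler_pM2r// acos_lepi.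
  have cosa : 0 < cos a.
    by apply: cos_gt0_pihalf; rewrite api andbT; have := pi_gt0 R; lra.
  have sina : 0 <= sin a.
    by apply: sin_ge0_pi; rewrite a0/=; have := pi_gt0 R; lra.
  split; first by rewrite divr_ge0// ltW.
  have cE : c = 2 * cos a ^+ 2 - 1 by rewrite -ca cos_mulr2n; ring.
  rewrite cE /tan expr_div_n sin2cos2; field.
  exact: lt0r_neq0.
have npi c : -1 <= c <= 1 -> acos c / 2 = pi / 2 -> c = -1.
  move=> cb e; have := acosK cb => <-.
  by rewrite (divIf _ e) ?pnatr_eq0// cospi.
have C2 : 0 <= C ^+ 2 by apply: sqr_ge0.
(* An infinite tangent for [c2] against a finite one for [c1] is absurd; if [c1 = -1], the left side
   vanishes. *)
rewrite /etan; case: eqP => [/npi c2E|/eqP /tanP [] // t20 t2E];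
  case: eqP => [/npi c1E|/eqP /tanP [] // t10 t1E] //.
- by rewrite c1E// addrN mulr0 mulr_ge0// mulr_ge0//; lra.
- by rewrite c1E// addrN mulr0 mulr_ge0// mulr_ge0//; lra.
rewrite -EFinM lee_fin => le.
rewrite -t2E -t1E.
(* The sign of [C] is unknown, but [C * tan (acos c1 / 2)] dominates a nonnegative number, so
   squaring preserves the order. *)
have : tan (acos c2 / 2) ^+ 2 <= (C * tan (acos c1 / 2)) ^+ 2.
  by rewrite ler_sqr ?nnegrE// (le_trans t20).
rewrite exprMn => sq.
rewrite -mulrA -[leRHS]mulrA [(1 + c2) * _]mulrC.
have : 0 <= (1 + c1) * (1 + c2) by apply: mulr_ge0; lra.
move=> /(ler_wpM2r); move=> /(_ _ _ sq); lra.
Qed.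

(** Replacing [v] by [- v] negates both cosines, so the one-sided hypothesis also yields the reverse
    comparison. *)
Lemma angular_cos_le (R : realType) (X : lmodType R) (N1 N2 : vnorm X) :
  angularly_equivalent N1 N2 ->
  exists2 K : R, 0 < K & forall z v : X, z != 0 -> v != 0 ->
    1 - mean_dnorm N1 z v / N1 v <= K * (1 - mean_dnorm N2 z v / N2 v) /\
    1 - mean_dnorm N2 z v / N2 v <= K * (1 - mean_dnorm N1 z v / N1 v).
Proof.
move=> [C hC].
have half z v : z != 0 -> v != 0 ->
    let c1 := mean_dnorm N1 z v / N1 v in
    let c2 := mean_dnorm N2 z v / N2 v in
    (1 - c2) * (1 + c1) <= C ^+ 2 * ((1 - c1) * (1 + c2)).
  move=> z0 v0; apply: etan_acos_le; try exact: mean_dnorm_cos.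
  by rewrite -!norm_angleE//; exact: hC.
(* Split [2 (1 - c1) = (1 - c1) (1 + c2) + (1 - c1) (1 - c2)]. The first term is at most
   [C ^+ 2 * ((1 + c1) (1 - c2))], and [1 + c1] and [1 - c1] are at most 2. *)
exists (1 + C ^+ 2); first by rewrite ltr_pwDl// sqr_ge0.
move=> z v z0 v0.
have := half z v z0 v0; have := half z (- v) z0 ltac:(by rewrite oppr_eq0).
rewrite /= !mean_dnormN !vnormN !mulNr !opprK.
have := mean_dnorm_cos N1 z v0; have := mean_dnorm_cos N2 z v0.
set c1 := mean_dnorm N1 z v / N1 v; set c2 := mean_dnorm N2 z v / N2 v.
have : 0 <= C ^+ 2 by apply: sqr_ge0.
move: (C ^+ 2) => D D0 /andP[c2l c2u] /andP[c1l c1u] h1 h2.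
have p1 : 0 <= (1 - c1) * (1 - c2) by apply: mulr_ge0; lra.
have p2 : 0 <= (1 - c1) * (1 + c2) by apply: mulr_ge0; lra.
have p3 : 0 <= (1 + c1) * (1 - c2) by apply: mulr_ge0; lra.
have p4 : 0 <= D * ((1 - c1) * (1 - c2)) by apply: mulr_ge0; lra.
have p5 : 0 <= D * ((1 - c1) * (1 + c2)) by apply: mulr_ge0; lra.
have p6 : 0 <= D * ((1 + c1) * (1 - c2)) by apply: mulr_ge0; lra.
split; nra.
Qed.

(** Dividing an exposing functional by its supremum on the ball gives [f <= N]; conversely this
    bound gives [f] its continuity. Uniqueness becomes proportionality, so the topology
    disappears. *)
Lemma exposed_pointP (R : realType) (X : lmodType R) (N : vnorm X) (x : X) :
  x != 0 ->
  exposed_point (closed_unit_ball (normed_by N)) ((N x)^-1 *: x) <->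
  exists f : {linear X -> R^o}, [/\ forall v, f v <= N v, f x = N x &
    forall v, f v = N v -> N x *: v = N v *: x].
Proof.
move=> x0; have Nx0 := vnorm_gt0 N x0.
have ballE (v : X) : closed_unit_ball (normed_by N) v = (N v <= 1) by [].
have ball_dir (v : X) : v != 0 -> closed_unit_ball (normed_by N) ((N v)^-1 *: v).
  move=> v0; have Nv0 := vnorm_gt0 N v0.
  by rewrite ballE vnormZp ?invr_ge0 ?vnorm_ge0// mulVf// lt0r_neq0.
split=> [[_ [f [_ fub fx funiq]]]|[f [fN fx funiq]]].
- set S := sup _ in fx funiq.
  have f_le (v : X) : closed_unit_ball (normed_by N) v -> f v <= S.
    by move=> vB; apply: ub_le_sup => //; exists v.
  have B0 : closed_unit_ball (normed_by N) (0 : X).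
    by rewrite ballE vnorm0 ler01.
  (* If the supremum were 0, it would also be attained at 0, so the exposed point would be 0. *)
  have S0 : 0 < S.
    have := f_le 0 B0; rewrite linear0 le_eqVlt => /orP[/eqP S0|//].
    have := funiq 0 B0; rewrite linear0 => /(_ S0) /esym/eqP.
    by rewrite scaler_eq0 invr_eq0 (gt_eqF Nx0) (negbTE x0).
  have fZ (t : R) (v : X) : f (t *: v) = t * f v by exact: (linearZ_LR f t v).
  have hlin : linear (fun v : X => S^-1 * f v : R^o).
    move=> t u v; rewrite -[t *: (_ : R^o)]/(t * _) mulrCA -mulrDr.
    by congr (_ * _); exact: (linearP f t u v).
  pose hL := GRing.isLinear.Build R X R^o *:%R _ hlin.
  pose h : {linear X -> R^o} := HB.pack (fun v : X => S^-1 * f v : R^o) hL.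
  exists h; split => [v||v] /=.
  + have [->|v0] := eqVneq v 0.
      by rewrite (linear0 f) mulr0 vnorm0.
    have Nv0 := vnorm_gt0 N v0.
    have := f_le _ (ball_dir v v0); rewrite fZ.
    by rewrite !ler_pdivrMl// mulrC.
  + move: fx; rewrite fZ => fx.
    have -> : f x = N x * S by rewrite -fx mulVKf// lt0r_neq0.
    by rewrite mulrCA mulVf ?mulr1// lt0r_neq0.
  + have [->|v0] := eqVneq v 0; first by rewrite vnorm0 scaler0 scale0r.
    have Nv0 := vnorm_gt0 N v0.
    move=> fv; have := funiq _ (ball_dir v v0); rewrite fZ.
    have -> : f v = S * N v by rewrite -fv mulVKf// lt0r_neq0.
    rewrite mulrCA mulVf ?lt0r_neq0// mulr1 => /(_ erefl).
    move=> /(congr1 (fun y : X => (N x * N v) *: y)).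
    rewrite !scalerA mulrK ?unitfE ?lt0r_neq0//.
    by rewrite mulrAC mulfV ?mul1r// lt0r_neq0.
- have xN : f ((N x)^-1 *: x) = 1.
    by rewrite linearZ_LR fx /= [LHS]mulVf// lt0r_neq0.
  set B := closed_unit_ball (normed_by N).
  have fub : ubound (f @` B : set R) 1.
    by move=> _ [v vB <-]; exact: le_trans (fN v) vB.
  have supE : sup (f @` B : set R) = 1.
    apply/eqP; rewrite eq_le; apply/andP; split.
      by apply: ge_sup => //; exists 1, ((N x)^-1 *: x) => //; exact: ball_dir.
    by apply: ub_le_sup; [exists 1|exists ((N x)^-1 *: x) => //; exact: ball_dir].
  split; first exact: ball_dir.
  have flin : linear (f : normed_by N -> R^o) by move=> t u v; exact: linearP.
  pose hL := GRing.isLinear.Build R (normed_by N) R^o *:%R _ flin.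
  pose h : {linear normed_by N -> R^o} := HB.pack (f : normed_by N -> R^o) hL.
  exists h; rewrite supE; split => //.
  + apply: bounded_linear_continuous; apply/linear_boundedP; exists 1; split => //.
    move=> r r1 v; apply: le_trans (_ : N v <= _).
      rewrite ler_norml fN andbT -lerN2 opprK -(vnormN N v).
      by rewrite -(linearN f) fN.
    by rewrite -[N v]mul1r ler_wpM2r ?vnorm_ge0// ltW.
  + by exists 1.
  + move=> y yB fy; have Ny : N y = 1.
      by apply/eqP; rewrite eq_le [N y <= 1]yB/= -fy fN.
    have := funiq y; rewrite Ny scale1r => /(_ fy).
    by move=> /(canRL (scalerK (lt0r_neq0 Nx0))).
Qed.

(** * Points where two norms are almost differentiable *)

Section AlmostSmooth.
Variables (R : realType) (X : lmodType R).
Implicit Types (N M : vnorm X) (u v x y z : X) (s : seq X) (t e d : R).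

(** Divided by [t], it bounds the gap between right and left derivatives at [z] along [v]; unlike
    that gap, it is Lipschitz in [z]. *)
Definition diff2 N z v t : R := N (z + t *: v) + N (z - t *: v) - 2 * N z.

Lemma diff2_ge0 N z v t : 0 <= diff2 N z v t.
Proof.
rewrite /diff2; have := vnormD N (z + t *: v) (z - t *: v).
have -> : z + t *: v + (z - t *: v) = 2 *: z.
  by rewrite addrACA subrr addr0 scaler_nat mulr2n.
by rewrite vnormZp//; lra.
Qed.

Lemma diff2_lip N z y v t : diff2 N z v t <= diff2 N y v t + 4 * N (z - y).
Proof.
rewrite /diff2; have addBr (a b c : X) : a + c - (b + c) = a - b.
  by rewrite opprD addrACA subrr addr0.
have := vnormB_le N (z + t *: v) (y + t *: v).
have := vnormB_le N (z - t *: v) (y - t *: v).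
have := vnormB_le N y z.
by rewrite !addBr [N (y - z)]vnormBC; lra.
Qed.

Lemma dnormDN_le N z v t : 0 < t ->
  t * (dnorm N z v + dnorm N z (- v)) <= diff2 N z v t.
Proof.
move=> t0; have := dnorm_le N z v t0; have := dnorm_le N z (- v) t0.
by rewrite /diff2 scalerN; lra.
Qed.

(* The second differences along [z, z + t v, z + 2 t v, ...] telescope to at
   most [2 t N v], so one of them is at most the average. *)
Lemma diff2_small N z v e d : 0 < e -> 0 < d ->
  exists y t, [/\ 0 < t, N (y - z) < d & diff2 N y v t < e * t].
Proof.
move=> e0 d0.
(* With this many points, second differences all at least [e * t] would add up to more than
   [2 * t * N v]. *)
pose m := Num.bound (2 * N v / e).
have mP : 2 * N v < e * m%:R.
  rewrite [ltRHS]mulrC -ltr_pdivrMr//; apply: archi_boundP.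
  by rewrite divr_ge0 ?mulr_ge0 ?vnorm_ge0// ltW.
have Nv1 : 0 < N v + 1 by have := vnorm_ge0 N v; lra.
have mN0 : 0 < m.+1%:R * (N v + 1) by rewrite mulr_gt0// ltr0n.
(* The step is short enough for all [m] points to stay within [d] of [z]; [N v + 1] is positive even
   when [N v = 0]. *)
have [t t0 tE] : exists2 t, 0 < t & t * (m.+1%:R * (N v + 1)) = d.
  by exists (d / (m.+1%:R * (N v + 1))); rewrite ?divr_gt0// divfK// lt0r_neq0.
pose y k := z + (k.+1%:R * t) *: v.
have yd k : (k < m)%N -> N (y k - z) < d.
  move=> km; rewrite /y addrAC subrr add0r vnormZp; last first.
    by rewrite mulr_ge0 ?ler0n ?ltW.
  rewrite -tE [k.+1%:R * t]mulrC -!mulrA ltr_pM2l//.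
  apply: le_lt_trans (_ : m.+1%:R * N v < _).
    by rewrite ler_wpM2r ?vnorm_ge0// ler_nat ltnW.
  by rewrite ltr_pM2l ?ltr0n// ltrDl.
have [[k km]|nex] := pselect (exists2 k, (k < m)%N & diff2 N (y k) v t < e * t).
  by exists (y k), t; split => //; exact: yd.
exfalso.
have big k : (k < m)%N -> e * t <= diff2 N (y k) v t.
  by move=> km; rewrite leNgt; apply/negP => lt; apply: nex; exists k.
pose psi k := N (z + (k.+1%:R * t) *: v) - N (z + (k%:R * t) *: v).
have psiE k : diff2 N (y k) v t = psi k.+1 - psi k.
  rewrite /diff2 /psi /y.
  have -> : z + (k.+1%:R * t) *: v + t *: v = z + (k.+2%:R * t) *: v.
    by rewrite -addrA -scalerDl -[k.+2]addn1 natrD mulrDl mul1r.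
  have -> : z + (k.+1%:R * t) *: v - t *: v = z + (k%:R * t) *: v.
    by rewrite -addrA -scalerBl -[k.+1]addn1 natrD mulrDl mul1r addrK.
  by lra.
have psiT k : `|psi k| <= t * N v.
  have E : N (z + (k.+1%:R * t) *: v - (z + (k%:R * t) *: v)) = t * N v.
    rewrite opprD addrACA subrr add0r -scalerBl -natr1 mulrDl mul1r.
    by rewrite addrAC subrr add0r vnormZp// ltW.
  rewrite ler_norml lerNl opprB /psi -E vnormB_le andbT.
  by rewrite vnormBC vnormB_le.
have : \sum_(0 <= k < m) e * t <= \sum_(0 <= k < m) (psi k.+1 - psi k).
  rewrite big_nat_cond [leRHS]big_nat_cond; apply: ler_sum => k.
  by rewrite andbT => /andP[_ km]; rewrite -psiE big.
rewrite telescope_sumr// sumr_const_nat subn0 -mulr_natr.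
have := psiT m; have := psiT 0; rewrite !ler_norml => /andP[p0 _] /andP[_ pm] le.
have : t * (2 * N v) < t * (e * m%:R) by rewrite ltr_pM2l.
lra.
Qed.

(** Smallness along the directions already treated persists on a ball, inside which the base point
    is moved to treat the next one. *)
Lemma diff2_small_seq N s z e d : 0 < e -> 0 < d ->
  exists y (r : R), [/\ 0 < r, N (y - z) < d & forall y', N (y' - y) < r ->
    forall v, v \in s -> exists2 t : R, 0 < t & diff2 N y' v t < e * t].
Proof.
move=> e0; elim: s z d => [|v s IHs] z d d0.
  by exists z, 1; rewrite subrr vnorm0; split.
have d20 : 0 < d / 2 by rewrite divr_gt0.
have [y [r [r0 yz yP]]] := IHs z _ d20.
have m0 : 0 < Num.min (d / 2) (r / 2) by rewrite lt_min d20 divr_gt0.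
have [y' [t [t0 y'y y't]]] := diff2_small N y v e0 m0.
move: y'y; rewrite lt_min => /andP[y'd y'r].
(* The first bound keeps the new ball inside the old one; the second is the slack in direction [v]
   over the Lipschitz constant 4. *)
exists y', (Num.min (r / 2) ((e * t - diff2 N y' v t) / 4)); split.
- by rewrite lt_min !divr_gt0// subr_gt0.
- have := vnormD N (y' - y) (y - z); rewrite subrKA; lra.
move=> w; rewrite lt_min => /andP[wr wt] u; rewrite in_cons => /orP[/eqP->|us].
  by exists t => //; have := diff2_lip N w y' v t; lra.
apply: yP us; have := vnormD N (w - y') (y' - y); rewrite subrKA; lra.
Qed.

Lemma vnorm_addD N M u v : N (u + v) + M (u + v) <= N u + M u + (N v + M v).
Proof. by rewrite addrACA lerD ?vnormD. Qed.

Lemma vnorm_addZ N M t v : N (t *: v) + M (t *: v) = `|t| * (N v + M v).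
Proof. by rewrite !vnormZ mulrDr. Qed.

Lemma vnorm_add_eq0 N M v : N v + M v = 0 -> v = 0.
Proof.
move=> h; apply: (@vnorm_eq0 _ _ N).
by have := vnorm_ge0 N v; have := vnorm_ge0 M v; lra.
Qed.

Definition vnorm_add N M : vnorm X :=
  VNorm (@vnorm_addD N M) (@vnorm_addZ N M) (@vnorm_add_eq0 N M).

(** One point serves both norms: a second difference of [N + M] is the sum of those of [N] and [M],
    both nonnegative. *)
Lemma almost_smooth_point N M s x e : 0 < e ->
  exists z, [/\ N (z - x) < e, M (z - x) < e & forall v, v \in s ->
    dnorm N z v + dnorm N z (- v) <= e /\ dnorm M z v + dnorm M z (- v) <= e].
Proof.
move=> e0.
have [z [r [r0 zx zP]]] := diff2_small_seq (vnorm_add N M) s x e0 e0.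
exists z; have := vnorm_ge0 N (z - x); have := vnorm_ge0 M (z - x).
move: zx; rewrite /= => zx M0 N0; split; [lra|lra|] => v vs.
have [|t t0 tP] := zP z _ v vs; first by rewrite subrr vnorm0.
have E : diff2 (vnorm_add N M) z v t = diff2 N z v t + diff2 M z v t.
  by rewrite /diff2 /=; ring.
have := dnormDN_le N z v t0; have := dnormDN_le M z v t0.
have := diff2_ge0 N z v t; have := diff2_ge0 M z v t.
by split; rewrite -(ler_pM2l t0); lra.
Qed.

End AlmostSmooth.

(** * Transfer of exposedness from the first norm to the second *)

Section OneDirection.
Variables (R : realType) (X : lmodType R) (N1 N2 : vnorm X) (K : R).
Hypothesis K0 : 0 < K.
Hypothesis cos_le : forall z v : X, z != 0 -> v != 0 ->
  1 - mean_dnorm N1 z v / N1 v <= K * (1 - mean_dnorm N2 z v / N2 v).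
Implicit Types (u v x y z : X) (s : seq X).

(** Additivity of [N2] makes the [N2]-angles from [z = x + y] to [x] and [y] zero, hence also the
    [N1]-angles. Subadditivity of the derivative of [N1] at [z] along [- x] and [- y] then gives
    [N1 x + N1 y <= N1 z]. *)
Lemma vnorm_add_transfer x y : x != 0 -> y != 0 ->
  N2 (x + y) = N2 x + N2 y -> N1 (x + y) = N1 x + N1 y.
Proof.
move=> x0 y0 N2xy; set z := x + y in N2xy *.
have z0 : z != 0.
  apply: contraTneq (vnorm_gt0 N2 x0) => zE; move: N2xy.
  by rewrite zE vnorm0; have := vnorm_gt0 N2 y0; lra.
have half u v : u != 0 -> z = u + v -> N2 z = N2 u + N2 v ->
    dnorm N1 z (- u) <= - N1 u.
  move=> u0 zE N2z.
  have h : dnorm N2 z (- u) <= - N2 u.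
    have := dnorm_le N2 z (- u) ltr01.
    by rewrite mul1r scale1r {2}zE addrAC subrr add0r N2z; lra.
  have D2 : mean_dnorm N2 z u / N2 u = 1.
    apply/eqP; rewrite eq_le (andP (mean_dnorm_cos N2 z u0)).2/=.
    rewrite ler_pdivlMr ?vnorm_gt0// mul1r /mean_dnorm.
    by have := sublinear_geN (dnorm_sublinear N2 z) u; lra.
  have := cos_le z0 u0; rewrite D2 subrr mulr0 subr_le0.
  rewrite ler_pdivlMr ?vnorm_gt0// mul1r /mean_dnorm.
  by have := dnorm_le_norm N1 z u; lra.
have hx := half x y x0 erefl N2xy.
have hy : dnorm N1 z (- y) <= - N1 y.
  by apply: (half y x y0); [rewrite addrC|rewrite N2xy addrC].
have := (dnorm_sublinear N1 z).1 (- x) (- y).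
by rewrite -opprD dnormN_self; have := vnormD N1 x y; rewrite -/z; lra.
Qed.

(** The cosine inequality is summed at an almost smooth [z] near [x]. Using derivatives along [- u]
    for [N1] and along [u] for [N2], subadditivity bounds both sums below by derivatives along
    multiples of [x]. *)
Lemma vnorm_sum_le x s (r : R) : x != 0 -> 0 < r ->
  (forall u, u \in s -> u != 0 /\ N1 u <= r * N2 u) ->
  \sum_(u <- s) u = (size s)%:R *: x ->
  \sum_(u <- s) (N1 u - N1 x) <= K * r * \sum_(u <- s) (N2 u - N2 x).
Proof.
move=> x0 r0 sP sx.
set n : R := (size s)%:R.
have n0 : 0 <= n by rewrite ler0n.
have sumc (c : R) : \sum_(u <- s) c = n * c.
  by rewrite big_const_seq count_predT iter_addr_0 mulr_natl.
have Kr0 : 0 < K * r by rewrite mulr_gt0.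
apply/ler_addgt0Pr => e e0.
have D0 : 0 < n * (3 * (K * r) + 1) + 1.
  by rewrite ltr_wpDl// mulr_ge0//; lra.
(* Per vector the loss is [d] for [N1], and for [N2] it is [d] from the derivative gap plus [2 * d]
   from replacing [z] by [x]. The bound [N1 x] keeps [z] non-zero. *)
set d := Num.min (e / (n * (3 * (K * r) + 1) + 1)) (N1 x).
have d0 : 0 < d by rewrite lt_min divr_gt0// vnorm_gt0.
have de : n * (3 * (K * r) + 1) * d <= e.
  apply: le_trans (_ : (n * (3 * (K * r) + 1) + 1) * d <= _).
    by rewrite ler_pM2r// lerDl.
  by rewrite mulrC -ler_pdivlMr// ge_min lexx.
have [z [zx1 zx2 zs]] := almost_smooth_point N1 N2 s x d0.
have z0 : z != 0.
  apply: contraTneq zx1 => ->; rewrite sub0r vnormN -leNgt.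
  by rewrite ge_min lexx orbT.
have pt u : u \in s ->
    N1 u + dnorm N1 z (- u) - d <= K * r * (N2 u - dnorm N2 z u + d).
  move=> us; have [u0 ur] := sP u us; have [j1 j2] := zs u us.
  have Nu1 := vnorm_gt0 N1 u0; have Nu2 := vnorm_gt0 N2 u0.
  have := cos_le z0 u0; rewrite -(ler_pM2l Nu1).
  have c2 : 0 <= K * (1 - mean_dnorm N2 z u / N2 u).
    by rewrite mulr_ge0 ?(ltW K0)// subr_ge0; case/andP: (mean_dnorm_cos N2 z u0).
  have := ler_wpM2r c2 ur.
  have -> : r * N2 u * (K * (1 - mean_dnorm N2 z u / N2 u)) =
            K * r * (N2 u - mean_dnorm N2 z u).
    by field; exact: lt0r_neq0.
  have -> : N1 u * (1 - mean_dnorm N1 z u / N1 u) = N1 u - mean_dnorm N1 z u.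
    by field; exact: lt0r_neq0.
  move=> h2 h1; have h := le_trans h1 h2.
  apply: le_trans (_ : N1 u - mean_dnorm N1 z u <= _).
    by rewrite /mean_dnorm; lra.
  apply: le_trans h _; rewrite ler_pM2l// /mean_dnorm; lra.
have := sublinear_sum (dnorm_sublinear N1 z) s (fun u => - u).
rewrite sumrN sx => S1.
have := sublinear_sum (dnorm_sublinear N2 z) s id; rewrite /= sx => S2.
have lo1 : - (n * N1 x) <= dnorm N1 z (- (n *: x)).
  by rewrite -vnormZp// -(vnormN N1 (n *: x)) dnorm_geN.
have lo2 : n * (N2 x - 2 * d) <= dnorm N2 z (n *: x).
  have := (dnorm_sublinear N2 z).1 x (z - x); rewrite subrKC dnorm_self.
  have := dnorm_le_norm N2 z (z - x); have := vnormB_le N2 x z.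
  rewrite vnormBC => a b c.
  have [s0|s0] := posnP (size s).
    by rewrite /n s0 mul0r scale0r (sublinear0 (dnorm_sublinear N2 z)).
  rewrite (sublinearZ (dnorm_sublinear N2 z)) ?ltr0n// ler_wpM2l//; lra.
have : \sum_(u <- s) (N1 u + dnorm N1 z (- u) - d) <=
       \sum_(u <- s) K * r * (N2 u - dnorm N2 z u + d).
  by rewrite big_seq [leRHS]big_seq; apply: ler_sum.
have -> : \sum_(u <- s) (N1 u + dnorm N1 z (- u) - d) =
    \sum_(u <- s) N1 u + \sum_(u <- s) dnorm N1 z (- u) - n * d.
  by rewrite sumrB big_split/= sumc.
have -> : \sum_(u <- s) K * r * (N2 u - dnorm N2 z u + d) =
    K * r * (\sum_(u <- s) N2 u - \sum_(u <- s) dnorm N2 z u + n * d).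
  by rewrite -mulr_sumr big_split/= sumrB sumc.
rewrite !sumrB !sumc.
move: S1 S2 lo1 lo2 de; rewrite -/n.
move: (\sum_(u <- s) N1 u) (\sum_(u <- s) N2 u) => A1 A2.
move: (\sum_(u <- s) dnorm N1 z (- u)) (\sum_(u <- s) dnorm N2 z u) => B1 B2.
move=> S1 S2 lo1 lo2 de h.
have : K * r * (A2 - B2 + n * d) <= K * r * (A2 - n * (N2 x - 2 * d) + n * d).
  by rewrite ler_pM2l//; lra.
by move: (K * r) => k in h de *; lra.
Qed.

(** By monotonicity of the quotients, the least of the steps found for the separate directions
    serves all of them. *)
Lemma dquot_sum_adherent (N : vnorm X) x s (h0 e : R) : 0 < h0 -> 0 < e ->
  exists h, [/\ 0 < h, h <= h0 &
    \sum_(v <- s) dquot N x v h <= \sum_(v <- s) dnorm N x v + e].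
Proof.
move=> h00; elim: s e => [|v s IHs] e e0.
  by exists h0; rewrite !big_nil add0r; split => //; exact: ltW.
have e20 : 0 < e / 2 by rewrite divr_gt0.
have [h [hp hh0 hs]] := IHs _ e20.
have [_ [t /= t0 <-] tv] := inf_adherent e20 (dquot_has_inf N x v).
have m0 : 0 < Num.min h t by rewrite lt_min hp.
exists (Num.min h t); split => //; first by rewrite ge_min hh0.
rewrite !big_cons.
have : dquot N x v (Num.min h t) <= dquot N x v t.
  by apply: dquot_homo; rewrite // ge_min lexx orbT.
have : \sum_(w <- s) dquot N x w (Num.min h t) <= \sum_(w <- s) dquot N x w h.
  by apply: ler_sum => w _; apply: dquot_homo; rewrite // ge_min lexx.
by move: tv; rewrite -/(dnorm N x v); lra.
Qed.

Lemma dnorm_sum_le x s : x != 0 -> \sum_(v <- s) v = 0 ->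
  \sum_(v <- s) dnorm N1 x v <=
  K * (4 * N1 x / N2 x) * \sum_(v <- s) dnorm N2 x v.
Proof.
move=> x0 s0; have Nx1 := vnorm_gt0 N1 x0; have Nx2 := vnorm_gt0 N2 x0.
(* For small [h], [N1 (x + h *: v) <= 2 * N1 x] and [N2 (x + h *: v) >= N2 x / 2], whence the factor
   4. *)
set r := 4 * N1 x / N2 x.
have r0 : 0 < r by rewrite divr_gt0// mulr_gt0.
have Kr0 : 0 < K * r by rewrite mulr_gt0.
apply/ler_addgt0Pr => e e0.
have e'0 : 0 < e / (K * r) by rewrite divr_gt0.
pose S (N : vnorm X) := 1 + \sum_(v <- s) N v.
have S0 (N : vnorm X) : 0 < S N.
  by rewrite ltr_pwDl// sumr_ge0// => v _; apply: vnorm_ge0.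
have NS (N : vnorm X) v : v \in s -> N v <= S N.
  move=> vs; rewrite /S (big_rem v vs)/=.
  have : 0 <= \sum_(w <- rem v s) N w by rewrite sumr_ge0// => w _; apply: vnorm_ge0.
  lra.
pose h0 := Num.min (N1 x / S N1) (N2 x / 2 / S N2).
have h00 : 0 < h0 by rewrite lt_min !divr_gt0.
have [h [hp hh0 hs]] := dquot_sum_adherent N2 x s h00 e'0.
have small1 v : v \in s -> h * N1 v <= N1 x.
  move=> vs; apply: le_trans (_ : h * S N1 <= _); first by rewrite ler_pM2l// NS.
  by rewrite -ler_pdivlMr// (le_trans hh0)// ge_min lexx.
have small2 v : v \in s -> h * N2 v <= N2 x / 2.
  move=> vs; apply: le_trans (_ : h * S N2 <= _); first by rewrite ler_pM2l// NS.
  by rewrite -ler_pdivlMr// (le_trans hh0)// ge_min lexx orbT.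
have usP u : u \in [seq x + h *: v | v <- s] -> u != 0 /\ N1 u <= r * N2 u.
  move=> /mapP[v vs ->].
  have b2 : N2 x / 2 <= N2 (x + h *: v).
    have := small2 v vs; have := vnormD N2 (x + h *: v) (- (h *: v)).
    by rewrite addrK vnormN (vnormZp _ _ (ltW hp)); lra.
  split.
    by apply: contraTneq b2 => ->; rewrite vnorm0 -ltNge divr_gt0.
  apply: le_trans (_ : r * (N2 x / 2) <= _); last by rewrite ler_pM2l.
  have -> : r * (N2 x / 2) = 2 * N1 x by rewrite /r; field; exact: lt0r_neq0.
  have := small1 v vs; have := vnormD N1 x (h *: v).
  by rewrite (vnormZp _ _ (ltW hp)); lra.
have usx : \sum_(u <- [seq x + h *: v | v <- s]) u =
    (size [seq x + h *: v | v <- s])%:R *: x.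
  rewrite big_map big_split/= -scaler_sumr s0 scaler0 addr0 size_map.
  by rewrite big_const_seq count_predT iter_addr_0 scaler_nat.
have := vnorm_sum_le x0 r0 usP usx; rewrite !big_map => le.
rewrite -(ler_pM2l hp).
apply: le_trans (_ : \sum_(v <- s) (N1 (x + h *: v) - N1 x) <= _).
  by rewrite mulr_sumr; apply: ler_sum => v _; exact: dnorm_le.
apply: le_trans le _.
have -> : \sum_(v <- s) (N2 (x + h *: v) - N2 x) = h * \sum_(v <- s) dquot N2 x v h.
  by rewrite mulr_sumr; apply: eq_bigr => v _; rewrite mulVKf// lt0r_neq0.
rewrite mulrCA ler_pM2l//.
apply: le_trans (_ : K * r * (\sum_(v <- s) dnorm N2 x v + e / (K * r)) <= _).
  by rewrite ler_pM2l.
by rewrite mulrDr [X in _ + X]mulrC divfK// lt0r_neq0.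
Qed.

Lemma exposed_transfer x : x != 0 ->
  exposed_point (closed_unit_ball (normed_by N1)) ((N1 x)^-1 *: x) ->
  exposed_point (closed_unit_ball (normed_by N2)) ((N2 x)^-1 *: x).
Proof.
move=> x0 /(exposed_pointP N1 x0)[f0 [f0N f0x f0u]].
apply/(exposed_pointP N2 x0).
have Nx1 := vnorm_gt0 N1 x0; have Nx2 := vnorm_gt0 N2 x0.
set k := K * (4 * N1 x / N2 x).
have k0 : 0 < k by rewrite mulr_gt0// divr_gt0// mulr_gt0.
pose r v := dnorm N2 x v - k^-1 * (dnorm N1 x v - f0 v).
have linDZ (h : {linear X -> R^o}) (t : R) u v : h (u + t *: v) = h u + t * h v :> R.
  by rewrite linearD; congr (_ + _); exact: (linearZ_LR h).
have f0dn v : f0 v <= dnorm N1 x v.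
  apply: dnorm_ge => t t0; have := f0N (x + t *: v).
  by rewrite linDZ f0x; lra.
have [||f fr] := @linear_minorant R X r.
- move=> t v t0; rewrite /r !(sublinearZ (dnorm_sublinear _ _))//.
  by rewrite -[t *: v]add0r linDZ linear0; ring.
- move=> s s0; rewrite /r sumrB -mulr_sumr sumrB.
  have -> : \sum_(v <- s) f0 v = 0 by rewrite -(linear_sum f0) s0 linear0.
  rewrite subr0 subr_ge0 ler_pdivrMl//.
  exact: dnorm_sum_le.
have fN v : f v <= N2 v.
  apply: le_trans (fr v) _; apply: le_trans (dnorm_le_norm N2 x v).
  by rewrite /r gerBl mulr_ge0 ?invr_ge0 ?(ltW k0)// subr_ge0.
have fx : f x = N2 x.
  apply/eqP; rewrite eq_le fN/=.
  (* Along [- x] the bound on [f] is at most [- N2 x], which is the missing inequality. *)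
  have := fr (0 + (-1) *: x); rewrite linDZ linear0 !add0r scaleN1r /r dnormN_self.
  have : 0 <= k^-1 * (dnorm N1 x (- x) - f0 (- x)).
    by rewrite mulr_ge0 ?invr_ge0 ?(ltW k0)// subr_ge0.
  by lra.
exists f; split => // v fv.
have [->|v0] := eqVneq v 0; first by rewrite vnorm0 scaler0 scale0r.
(* As [f <= N2] with equality at [x] and [v], [N2] is additive on [x] and [t *: v]; additivity
   passes to [N1]. *)
have N1add t : 0 < t -> N1 (x + t *: v) = N1 x + t * N1 v.
  move=> t0; rewrite -(vnormZp _ _ (ltW t0)); apply: vnorm_add_transfer => //.
    by rewrite scaler_eq0 negb_or v0 lt0r_neq0.
  apply/eqP; rewrite eq_le vnormD/= (vnormZp _ _ (ltW t0)) -fx -fv.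
  by have := fN (x + t *: v); rewrite linDZ.
have dn1 : N1 v <= dnorm N1 x v.
  by apply: dnorm_ge => t t0; rewrite N1add//; lra.
have f0v : f0 v = N1 v.
  apply/eqP; rewrite eq_le f0N/= (le_trans dn1)// -subr_le0.
  rewrite -(pmulr_rle0 _ (_ : 0 < k^-1)) ?invr_gt0//.
  (* [N2 v = f v <= dnorm N2 x v - k^-1 * (dnorm N1 x v - f0 v)] and [dnorm N2 x v <= N2 v] leave no
     room for a positive difference. *)
  by have := fr v; rewrite fv /r; have := dnorm_le_norm N2 x v; lra.
have vE : v = (N1 v / N1 x) *: x.
  apply: (scalerI (lt0r_neq0 Nx1)).
  by rewrite f0u// scalerA mulrC divfK// lt0r_neq0.
have q0 : 0 <= N1 v / N1 x by rewrite divr_ge0 ?vnorm_ge0.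
have N2v : N2 v = N1 v / N1 x * N2 x by rewrite {1}vE vnormZp.
by rewrite N2v {1}vE scalerA mulrC.
Qed.

End OneDirection.

Theorem theorem21 (R : realType) (X : lmodType R) (N1 N2 : vnorm X)
    (hN : angularly_equivalent N1 N2) (x : X) (hx : x != 0) :
  exposed_point (closed_unit_ball (normed_by N1)) ((N1 x)^-1 *: x) <->
  exposed_point (closed_unit_ball (normed_by N2)) ((N2 x)^-1 *: x).
Proof.
have [K K0 hK] := angular_cos_le hN.
by split; apply: (exposed_transfer K0) => // z v z0 v0; have [] := hK z v z0 v0.
Qed.
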